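(* Let $\mathbb{A}$ be a finite alphabet with $\#\mathbb{A}=r\geq 2$ and let $x\in\mathbb{A}^{\mathbb{Z}^2}$ be non-doubly periodic by projection. Suppose that either (i) $x$ admits a transverse recurrence direction, or (ii) $x$ is strongly recurrent. Then for each positive integer $k$, $$p_x^{*\mathrm{ab}}(k)\geq (r-1)k+1.$$
   Context: Abelian maximal pattern complexity: for a finite set $S\subset\mathbb{Z}^2$ and $t\in\mathbb{Z}^2$, the $S$-factor of $x$ at $t$ is $x[t+S]=(x(t+s))_{s\in S}\in\mathbb{A}^S$. Two elements of $\mathbb{A}^S$ are Abelian equivalent if each letter of $\mathbb{A}$ occurs the same number of times in both. Let $p_x^{\mathrm{ab}}(S)$ be the number of Abelian equivalence classes of $S$-factors of $x$ (over all $t\in\mathbb{Z}^2$), and $p_x^{*\mathrm{ab}}(k)=\sup\{p_x^{\mathrm{ab}}(S): S\subset\mathbb{Z}^2,\ \#S=k\}$. Periods: for a word $y$ on $\mathbb{Z}^2$, $\operatorname{Per}(y)=\{p\in\mathbb{Z}^2: y(t+p)=y(t)\ \forall t\in\mathbb{Z}^2\}$, a subgroup of $\mathbb{Z}^2$. $y$ is doubly periodic if $\operatorname{Per}(y)$ contains two linearly independent vectors. For $\varnothing\neq B\subsetneq\mathbb{A}$, let $\pi_B(x)=\mathbf{1}_B\circ x\in\{0,1\}^{\mathbb{Z}^2}$ and $H_B=\operatorname{Per}(\pi_B(x))$. $x$ is doubly periodic by projection if $\pi_B(x)$ is doubly periodic for some $\varnothing\neq B\subsetneq\mathbb{A}$;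 otherwise $x$ is non-doubly periodic by projection. Directions: $\mathbb{P}^1(\mathbb{R})$ is the set of lines through $0$ in $\mathbb{R}^2$; $\operatorname{dir}(q)=\mathbb{R}q$ for $q\neq 0$; identifying $\mathbb{P}^1(\mathbb{R})$ with $\mathbb{R}/\pi\mathbb{Z}$ by angle, $d_\pi([\theta],[\phi])=\min_{m\in\mathbb{Z}}|\theta-\phi-m\pi|$. Let $\Sigma_N=[-N,N]^2\cap\mathbb{Z}^2$, and write $x[\Sigma_N+q]=x[\Sigma_N]$ for: $x(z+q)=x(z)$ for all $z\in\Sigma_N$. Strong recurrence: $x$ is strongly recurrent if there is $\delta>0$ such that for every $N\geq1$ there are nonzero $u_N,v_N\in\mathbb{Z}^2$ with $x[\Sigma_N+u_N]=x[\Sigma_N]=x[\Sigma_N+v_N]$ and $d_\pi(\operatorname{dir}(u_N),\operatorname{dir}(v_N))\geq\delta$. Recurrence directions: $\theta\in\mathbb{P}^1(\mathbb{R})$ is a recurrence direction of $x$ if for all $\varepsilon>0$ and $N\geq1$ there is $q\in\mathbb{Z}^2\setminus\{0\}$ with $x[\Sigma_N+q]=x[\Sigma_N]$ and $d_\pi(\operatorname{dir}(q),\theta)<\varepsilon$. $\mathcal{R}(x)$ is the set of all recurrence directions. If $H_B$ has rank one, $\phi_{H_B}\in\mathbb{P}^1(\mathbb{R})$ is the common direction of its nonzero elements. For $x$ non-doubly periodic by projection, $D_{\mathrm{bad}}(x)=\{\phi_{H_B}:\varnothing\neq B\subsetneq\mathbb{A},\ H_B\neq\{0\}\}$. A recurrence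 direction is transverse if it lies in $\mathcal{R}(x)\setminus D_{\mathrm{bad}}(x)$. *)

(* Defs.v *)
From mathcomp Require Import all_boot all_order all_algebra finmap.
From mathcomp Require Import all_classical all_reals all_analysis.

Set Implicit Arguments.
Unset Strict Implicit.
Unset Printing Implicit Defensive.

Import Order.TTheory GRing.Theory Num.Theory.

Local Open Scope classical_set_scope.
Local Open Scope ring_scope.

Notation Z2 := (int * int)%type.

Section AbelianComplexity.
Variables (A : finType) (x : Z2 -> A).

Definition S_factor (S : {fset Z2}) (t : Z2) : {ffun S -> A} :=
  [ffun s : S => x (t + val s)].

Definition abelian_equiv (S : {fset Z2}) : rel {ffun S -> A} :=
  fun u v => [forall a : A, #|[pred s | u s == a]| == #|[pred s | v s == a]|].

Definition factors (S : {fset Z2}) : {set {ffun S -> A}} :=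
  finset (fun u => `[< exists t : Z2, u = S_factor S t >]).

Definition abelian_complexity (S : {fset Z2}) : nat :=
  #|equivalence_partition (@abelian_equiv S) (factors S)|.

Definition max_pattern_abelian_complexity (R : realType) (k : nat) : \bar R :=
  ereal_sup [set ((abelian_complexity S)%:R)%:E
            | S in [set S : {fset Z2} | #|` S| = k]].

End AbelianComplexity.

Section Periods.

Definition Per (T : Type) (y : Z2 -> T) : set Z2 :=
  [set p | forall t, y (t + p) = y t].

Definition linearly_independent (p q : Z2) : Prop :=
  forall a b : int, p *~ a + q *~ b = 0 -> a = 0 /\ b = 0.

Definition doubly_periodic (T : Type) (y : Z2 -> T) : Prop :=
  exists p q, [/\ Per y p, Per y q & linearly_independent p q].

Definition letter_proj (A : finType) (B : {set A}) (x : Z2 -> A) : Z2 -> bool :=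
  fun t => x t \in B.

Definition proper_nonempty (A : finType) (B : {set A}) : bool :=
  (B != finset.set0) && (B \proper finset.setT).

Definition doubly_periodic_by_projection (A : finType) (x : Z2 -> A) : Prop :=
  exists2 B : {set A}, proper_nonempty B & doubly_periodic (letter_proj B x).

End Periods.

Section Directions.
Variable R : realType.

Definition line_through (v : R * R) : set (R * R) :=
  [set (c * v.1, c * v.2) | c in [set: R]].

Definition P1 : set (set (R * R)) :=
  [set L | exists2 v : R * R, v != 0 & L = line_through v].

Definition dir (q : Z2) : set (R * R) := line_through (q.1%:~R, q.2%:~R).

Definition has_angle (L : set (R * R)) (theta : R) : Prop :=
  L = line_through (cos theta, sin theta).

(* The angles of a line form a coset of pi Z, so for L, M in P1 the infimum is
   attained and already equals the minimum over m for any fixed choice of the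
   representatives theta, phi. *)
Definition dist_pi (L M : set (R * R)) : R :=
  inf [set d | exists theta phi (m : int),
         [/\ has_angle L theta, has_angle M phi
           & d = `|theta - phi - m%:~R * pi|]].

End Directions.

Section Recurrence.
Variables (R : realType) (A : finType) (x : Z2 -> A).

Definition Sigma (N : nat) : set Z2 :=
  [set z | `|z.1| <= N%:Z /\ `|z.2| <= N%:Z].

Definition returns (N : nat) (q : Z2) : Prop :=
  forall z, Sigma N z -> x (z + q) = x z.

Definition strongly_recurrent : Prop :=
  exists2 delta : R, 0 < delta & forall N : nat, (1 <= N)%N ->
    exists u v : Z2, [/\ u != 0, v != 0, returns N u, returns N v
                       & delta <= dist_pi (dir u) (dir v)].

Definition recurrence_directions : set (set (R * R)) :=
  [set theta | P1 theta /\
    forall (eps : R) (N : nat), 0 < eps -> (1 <= N)%N ->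
      exists q : Z2, [/\ q != 0, returns N q & dist_pi (dir q) theta < eps]].

(* The common direction of the nonzero elements of H_B is only meaningful when
   H_B has rank one; this is the case for every H_B != 0 as soon as x is
   non-doubly periodic by projection. *)
Definition bad_directions : set (set (R * R)) :=
  [set phi | exists B : {set A},
    [/\ proper_nonempty B, Per (letter_proj B x) <> [set 0]
      & forall h, Per (letter_proj B x) h -> h != 0 -> dir h = phi]].

Definition transverse_directions : set (set (R * R)) :=
  recurrence_directions `\` bad_directions.

End Recurrence.

(* Main.v *)
Require Import Defs.
From mathcomp Require Import all_boot all_order all_algebra finmap.
From mathcomp Require Import all_classical all_reals all_analysis.
From mathcomp Require Import ring zify.
Set Implicit Arguments.
Unset Strict Implicit.
Unset Printing Implicit Defensive.

Import Order.TTheory GRing.Theory Num.Theory.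
Import numFieldNormedType.Exports.
Local Open Scope classical_set_scope.
Local Open Scope ring_scope.

(** Call a return vector q good if, for every proper nonempty B, q is not a
period of 1_B(x), so that some z_B(q) has x(z_B(q)) and x(z_B(q) + q) on
different sides of B.  Either hypothesis yields, for every window, a good
vector returning on that window.

Fix an ultrafilter on the good returns and let phi(y, B), beta(B) be the limits
of x(z_B(q) - y) and x(z_B(q) + q); put alpha(B) = phi(0, B).  Choose positions
s_0, s_1, ... whose increments are generic returns on ever larger windows.  For
each m and B some translate of x shows phi(s_(m-1) - s_i, B) at the positions
s_i with i < m and then constantly alpha(B) (when q is not the next increment),
another one ends constantly in beta(B) (when it is).  A second limit argument,
along the indices, passes to a subsequence on which the letters before m are all
equal to some d(B).  One of alpha(B), beta(B) lies on the other side of B from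
d(B), so for every B there are letters c, e separated by B such that all
patterns c^j e^(k-j) occur on the first k positions.

Finally, starting from a single letter, each step adjoins to the current set C a
letter e with such patterns for some c in C; the k patterns which contain e have
new abelian classes.  This gives 1 + (r-1)k classes. *)

(** * Ultrafilter limits and recursive choice *)

Lemma ultrafilter_fin_lim (T : Type) (C : finType) (p : set_system T)
    (f : T -> C) :
  UltraFilter p -> exists c, \forall t \near p, f t = c.
Proof.
move=> pU; apply: contrapT => noc.
have ntc c : \forall t \near p, f t <> c.
  have [pc|//] := in_ultra_setVsetC [set t | f t = c] pU.
  by case: noc; exists c.
have : \forall t \near p, forall c, f t <> c by exact: filter_forall.
by move=> /filter_ex[t]; apply.
Qed.

Lemma filter_all_seq (T : Type) (I : eqType) (p : set_system T) (s : seq I)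
    (P : I -> T -> Prop) :
  Filter p -> (forall i, i \in s -> \forall t \near p, P i t) ->
  \forall t \near p, forall i, i \in s -> P i t.
Proof.
move=> pF; elim: s => [|i s IH] Ps.
  by apply: filterE => t i; rewrite in_nil.
have Hi := Ps i (mem_head _ _).
have Hs : \forall t \near p, forall j, j \in s -> P j t.
  by apply: IH => j js; apply: Ps; rewrite in_cons js orbT.
apply: filterS (filterI Hi Hs) => t [Pi Pt] j; rewrite in_cons => /orP[/eqP->//|].
exact: Pt.
Qed.

(** Dependent choice with the whole past in view; it drives both recursive constructions below. *)
Lemma history_choice (T : Type) (P : seq T -> T -> Prop) :
  (forall h, exists y, P h y) ->
  exists f : nat -> T, forall n, P (mkseq f n) (f n).
Proof.
move=> /choice[g gP].
pose hist := fix hist n := if n is m.+1 then rcons (hist m) (g (hist m)) else [::].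
exists (g \o hist) => n /=.
suff -> : mkseq (g \o hist) n = hist n by exact: gP.
by elim: n => //= n IH; rewrite mkseqS IH.
Qed.

(** The limits [F i] of [f i m] in m, then the limit [d] of [F], leave finitely many generic
    conditions at each stage. A greedy choice interlaces M 0 < I 0 < M 1 < I 1 < ..., each [M j]
    being generic for all earlier [I l]. *)
Lemma half_graph_ramsey (C : finType) (f : nat -> nat -> C) :
  exists d (I M : nat -> nat), forall l j,
    ((l < j)%N -> (I l < M j)%N /\ f (I l) (M j) = d) /\
    ((j <= l)%N -> (M j <= I l)%N).
Proof.
have [U [UU nU]] := @ultraFilterLemma nat \oo eventually_filter.
have far n : \forall m \near U, (n < m)%N by apply: nU; exact: nbhs_infty_gt.
have /choice[F FP] i : exists c, \forall m \near U, f i m = c.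
  exact: ultrafilter_fin_lim.
have [d dP] := ultrafilter_fin_lim F UU.
pose good (h : seq (nat * nat)) := forall e : nat * nat, e \in h -> F e.2 = d.
(* An entry of the history is a pair (M j, I j), chosen with M j < I j. *)
pose step (h : seq (nat * nat)) (e : nat * nat) := good h ->
  [/\ F e.2 = d, (e.1 < e.2)%N &
   forall e', e' \in h -> (e'.2 < e.1)%N /\ f e'.2 e.1 = d].
have [h|g gP] := @history_choice _ step.
  have [gh|ngh] := pselect (good h); last by exists (0, 0)%N.
  have : \forall m \near U, forall e', e' \in h -> (e'.2 < m)%N /\ f e'.2 m = d.
    apply: filter_all_seq => e' /gh Fe'.
    by near=> m; split; [near: m; exact: far|rewrite -Fe'; near: m; exact: FP].
  move=> /filter_ex[m hm].
  have /filter_ex[i [Fi mi]] : \forall i \near U, F i = d /\ (m < i)%N.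
    by apply: filterI; [exact: dP|exact: far].
  by exists (m, i).
have gg n : good (mkseq g n).
  elim: n => [|n IH] e; first by rewrite in_nil.
  rewrite mkseqS mem_rcons in_cons => /orP[/eqP->|/IH//].
  by have [] := gP n IH.
have gI l j : (l < j)%N -> ((g l).2 < (g j).1)%N /\ f (g l).2 (g j).1 = d.
  move=> lj; have [_ _] := gP j (gg j); apply.
  by apply/mapP; exists l; rewrite // mem_iota.
have gMI j : ((g j).1 < (g j).2)%N by have [] := gP j (gg j).
exists d, (fun l => (g l).2), (fun j => (g j).1) => l j; split; first exact: gI.
rewrite leq_eqVlt => /orP[/eqP->|/gI[jl _]]; first exact/ltnW.
by apply/ltnW/(ltn_trans (gMI j))/(ltn_trans jl)/gMI.
Unshelve. all: by end_near.
Qed.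

(** * Generic returns and two-letter patterns *)

Definition separates (A : finType) (B : {set A}) (a b : A) : bool :=
  (a \in B) != (b \in B).

(** One [q] has to work for all [B] at once. Windows are arbitrary finite sets, so the combinatorial
    part is independent of the geometry of the plane. *)
Definition aperiodic_recurrent (V : zmodType) (A : finType) (x : V -> A) :=
  forall F : seq V, exists2 q, forall z, z \in F -> x (z + q) = x z &
    forall B : {set A}, proper_nonempty B -> exists z, separates B (x z) (x (z + q)).

(** Good returns on growing windows generate a proper filter; an ultrafilter [p] refining it fixes
    the limiting letters around the witnesses. Any finitely many of these limits are attained at a
    common [q]. *)
Lemma generic_return (V : zmodType) (A : finType) (x : V -> A) :
  aperiodic_recurrent x ->
  exists (phi : V -> {ffun {set A} -> A}) (beta : {ffun {set A} -> A}),
  (forall B, proper_nonempty B -> separates B (phi 0 B) (beta B)) /\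
  forall Y F : seq V, exists q w,
    [/\ forall z, z \in F -> x (z + q) = x z,
        forall B, x (w B + q) = beta B &
        forall y, y \in Y -> forall B, x (w B - y) = phi y B].
Proof.
move=> xrec.
pose G (F : seq V) := [set q | (forall z, z \in F -> x (z + q) = x z) /\
  forall B, proper_nonempty B -> exists z, separates B (x z) (x (z + q))].
have Gfilter : ProperFilter (filter_from [set: seq V] G).
  apply: filter_from_proper; last first.
    by move=> F _; have [q] := xrec F; exists q.
  apply: filter_from_filter; first by exists [::].
  move=> F1 F2 _ _; exists (F1 ++ F2) => // q [qF qB]; split; split=> // z zF;
    by apply: qF; rewrite mem_cat zF ?orbT.
have [p [pU Gp]] := ultraFilterLemma Gfilter.
have pG F : \forall q \near p, G F q by apply: Gp; exists F.
(* The witnesses must depend on [q] alone and not on the window, hence the weakest condition [G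
   [::]]; elsewhere 0 is a dummy value. *)
have /choice[w wP] q : exists w : {set A} -> V,
    G [::] q -> forall B, proper_nonempty B -> separates B (x (w B)) (x (w B + q)).
  have [Gq|nGq] := pselect (G [::] q); last by exists (fun=> 0).
  have /choice[w wP] B : exists z, proper_nonempty B -> separates B (x z) (x (z + q)).
    have [PB|nPB] := pselect (proper_nonempty B); last by exists 0.
    by have [z zP] := Gq.2 B PB; exists z.
  by exists w.
have /choice[phi phiP] y :
    exists c, \forall q \near p, [ffun B => x (w q B - y)] = c.
  exact: ultrafilter_fin_lim.
have [beta betaP] := ultrafilter_fin_lim (fun q => [ffun B => x (w q B + q)]) pU.
exists phi, beta; split.
  move=> B PB.
  have /filter_ex[q [Gq <- <-]] : \forall q \near p,
      [/\ G [::] q, [ffun B => x (w q B - 0)] = phi 0 &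
          [ffun B => x (w q B + q)] = beta].
    by near=> q; split; near: q; [exact: pG|exact: phiP|exact: betaP].
  by rewrite !ffunE subr0; exact: wP.
move=> Y F.
have Yp : \forall q \near p, forall y, y \in Y -> [ffun B => x (w q B - y)] = phi y.
  by apply: filter_all_seq => y _; exact: phiP.
have /filter_ex[q [[qF _] qb qY]] : \forall q \near p,
    [/\ G F q, [ffun B => x (w q B + q)] = beta &
        forall y, y \in Y -> [ffun B => x (w q B - y)] = phi y].
  by near=> q; split; near: q; [exact: pG|exact: betaP|exact: Yp].
exists q, (w q); split=> // [B|y yY B]; first by rewrite -qb ffunE.
by rewrite -(qY y yY) ffunE.
Unshelve. all: by end_near.
Qed.

Lemma test_sequence (V : zmodType) (A : finType) (x : V -> A) :
  aperiodic_recurrent x ->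
  exists (s : nat -> V) (f : nat -> nat -> {ffun {set A} -> A})
    (alpha beta : {ffun {set A} -> A}),
  (forall B, proper_nonempty B -> separates B (alpha B) (beta B)) /\
  forall m B,
    (exists t, forall i, x (t + s i) = if (i < m)%N then f i m B else alpha B) /\
    (exists t, forall i, x (t + s i) = if (i < m)%N then f i m B else beta B).
Proof.
move=> xrec; have [phi [beta [sep gen]]] := generic_return xrec.
pose E := (V * (({set A} -> V) * ({set A} -> V)))%type.
pose lastpos (h : seq E) := last 0 [seq e.1 | e <- h].
(* An entry (s, (t, t')) of the history consists of a position and, for each B,
   of the translates whose letters become constantly alpha, resp. beta, from that
   position on. *)
pose step (h : seq E) (e : E) :=
  [/\ forall e', e' \in [seq e.1 | e <- h] -> forall B,
        x (e.2.1 B + e') = phi (lastpos h - e') B /\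
        x (e.2.2 B + e') = phi (lastpos h - e') B,
      forall B, x (e.2.1 B + e.1) = phi 0 B /\ x (e.2.2 B + e.1) = beta B &
      forall i B, (i < size h)%N -> let t := (nth e h i).2 in
        x (t.1 B + e.1) = x (t.1 B + lastpos h) /\
        x (t.2 B + e.1) = x (t.2 B + lastpos h)].
have [h|g gP] := @history_choice _ step.
  pose s := lastpos h.
  pose Y := 0 :: [seq s - y | y <- [seq e.1 | e <- h]].
  pose T := [seq (nth (0, (fun=> 0, fun=> 0)) h i).2.1 B + s
              | i <- iota 0 (size h), B <- enum [set: {set A}]%SET] ++
            [seq (nth (0, (fun=> 0, fun=> 0)) h i).2.2 B + s
              | i <- iota 0 (size h), B <- enum [set: {set A}]%SET].
  have [_ [w' [_ _ w'Y]]] := gen Y [::].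
  (* The increment [q] returns on the points [w' B], so the translates from [w'] show [phi 0 B] at
     the new position, whereas its own witness [w] gives [beta B]. Returning on [T] preserves the
     tails of all earlier translates. *)
  have [q [w [qF wb wY]]] := gen Y (T ++ [seq w' B | B <- enum [set: {set A}]%SET]).
  have Y0 : 0 \in Y by rewrite mem_head.
  have YY e' : e' \in [seq e.1 | e <- h] -> s - e' \in Y.
    by move=> eh; rewrite in_cons; apply/orP; right; apply/mapP; exists e'.
  exists (s + q, (fun B => w' B - s, fun B => w B - s)); split=> /=.
  - move=> e' eh B; rewrite -!addrA [- s + e']addrC -opprB.
    by split; [apply: w'Y|apply: wY]; exact: YY.
  - move=> B; rewrite !addrA !subrK; split=> //.
    rewrite qF ?mem_cat; first by rewrite -(w'Y 0) // subr0.
    by rewrite map_f ?orbT// mem_enum finset.in_setT.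
  - move=> i B ih; rewrite -/s !addrA.
    rewrite !(set_nth_default (0, (fun=> 0, fun=> 0)) _ ih).
    split; apply: qF; rewrite !mem_cat; apply/orP; left; apply/orP; [left|right];
      by apply: allpairs_f; rewrite ?mem_iota// mem_enum finset.in_setT.
pose s n := (g n).1; pose prev m := lastpos (mkseq g m).
have prevS m : prev m.+1 = s m by rewrite /prev /lastpos mkseqS map_rcons last_rcons.
exists s, (fun i m => phi (prev m - s i)), (phi 0), beta; split=> // m B.
have past i : (i < m)%N -> s i \in [seq e.1 | e <- mkseq g m].
  by move=> im; apply: map_f; apply/mapP; exists i; rewrite // mem_iota.
have [/(_ _ (past _ _)) gpast gnow _] := gP m.
(* By the third clause of [step], each position after m repeats the letter of the preceding one. *)
have fut n : x ((g m).2.1 B + s (m + n)%N) = phi 0 B /\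
             x ((g m).2.2 B + s (m + n)%N) = beta B.
  elim: n => [|n [IH1 IH2]]; first by rewrite addn0; exact: gnow.
  have mn : (m < (m + n).+1)%N by rewrite ltnS leq_addr.
  rewrite addnS; have [_ _] := gP (m + n).+1; move=> /(_ m B).
  rewrite size_mkseq (nth_mkseq _ _ mn) -/(prev _) prevS.
  by move=> /(_ mn) [E1 E2]; split; [exact: etrans E1 IH1|exact: etrans E2 IH2].
split; [exists ((g m).2.1 B)|exists ((g m).2.2 B)] => i; case: ltnP => im.
- by have [] := gpast i im B.
- by have [] := fut (i - m)%N; rewrite subnKC.
- by have [] := gpast i im B.
- by have [] := fut (i - m)%N; rewrite subnKC.
Qed.

(** The colours [f i m] are functions of [B], so one subsequence [I] serves every [B]. *)
Lemma two_letter_patterns (V : zmodType) (A : finType) (x : V -> A) :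
  aperiodic_recurrent x ->
  exists s : nat -> V, forall B : {set A}, proper_nonempty B ->
  exists c e, separates B c e /\
    forall j, exists t, forall l, x (t + s l) = if (l < j)%N then c else e.
Proof.
move=> xrec; have [s [f [alpha [beta [sep test]]]]] := test_sequence xrec.
have [d [I [M IM]]] := half_graph_ramsey f.
exists (s \o I) => B PB.
have pat e : (forall m, exists t, forall i,
      x (t + s i) = if (i < m)%N then f i m B else e) ->
    forall j, exists t, forall l, x (t + s (I l)) = if (l < j)%N then d B else e.
  (* Exactly the positions [I l] with l < j lie before the cut [M j], and there the letter is
     [d B]. *)
  move=> He j; have [t tP] := He (M j); exists t => l; rewrite tP.
  have [lj jl] := IM l j; case: (ltnP l j) => [/lj[-> ->]//|/jl].
  by rewrite leqNgt => /negbTE->.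
have := sep B PB; rewrite /separates => ab.
have [da|da] := eqVneq (d B \in B) (alpha B \in B).
  exists (d B), (beta B); rewrite /separates da; split=> //.
  by apply: pat => m; have [] := test m B.
exists (d B), (alpha B); split=> //.
by apply: pat => m; have [] := test m B.
Qed.


(** * Counting abelian classes *)

Definition parikh (V : zmodType) (A : finType) (x : V -> A) (k : nat)
    (s : nat -> V) (t : V) : {ffun A -> nat} :=
  [ffun a => #|[pred l : 'I_k | x (t + s l) == a]|].

Lemma card_ord_lt (k j : nat) : (j <= k)%N -> #|[pred l : 'I_k | (l < j)%N]| = j.
Proof.
move=> jk; rewrite -sum1_card.
rewrite (eq_bigl (fun l : 'I_k => (l < j)%N)) // -(big_ord_widen k (fun=> 1%N) jk).
by rewrite sum1_card card_ord.
Qed.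

Lemma card_ord_ge (k j : nat) :
  (j <= k)%N -> #|[pred l : 'I_k | (j <= l)%N]| = (k - j)%N.
Proof.
move=> jk; rewrite -[X in (X - _)%N]card_ord -(cardC [pred l : 'I_k | (l < j)%N]).
rewrite card_ord_lt // addKn; apply: eq_card => l.
by rewrite !inE -leqNgt.
Qed.

(** Letters are adjoined one at a time, keeping all patterns within the current set [C]. A new
    letter [e] brings k vectors, told apart from the old ones and from each other by their entry at
    [e]. *)
Lemma many_parikh_vectors (V : zmodType) (A : finType) (x : V -> A)
    (s : nat -> V) (k : nat) :
  (2 <= #|A|)%N ->
  (forall B : {set A}, proper_nonempty B -> exists c e, separates B c e /\
    forall j, exists t, forall l, x (t + s l) = if (l < j)%N then c else e) ->
  exists2 ts : seq V, size ts = ((#|A| - 1) * k + 1)%N &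
    uniq [seq parikh x k s t | t <- ts].
Proof.
move=> A2 pat.
(* The pair is oriented so that [e] is the letter outside [B]; when the inside letter comes first,
   cutting at k - j leaves j copies of [e]. *)
have mix (B : {set A}) : proper_nonempty B -> exists c e, [/\ c \in B, e \notin B &
    forall j, (j <= k)%N -> exists t, parikh x k s t e = j /\
      forall a, a != c -> a != e -> parikh x k s t a = 0%N].
  move=> /pat[c [e [ce tP]]].
  have other j t a : (forall l, x (t + s l) = if (l < j)%N then c else e) ->
      a != c -> a != e -> parikh x k s t a = 0%N.
    move=> xt ac ae; rewrite ffunE; apply: eq_card0 => l; rewrite !inE xt.
    by case: ifP; rewrite eq_sym => _; apply/negbTE.
  have necse : c != e by apply: contraNneq ce => ->; rewrite /separates eqxx.
  have [cB|cB] := boolP (c \in B).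
    have eB : e \notin B by move: ce; rewrite /separates cB; case: (e \in B).
    exists c, e; split=> // j jk; have [t xt] := tP (k - j)%N; exists t.
    split; last by move=> a; exact: (other _ _ _ xt).
    rewrite ffunE -[RHS](subKn jk) -(card_ord_ge (leq_subr j k)).
    apply: eq_card => l.
    by rewrite !inE xt; case: ltnP; rewrite ?eqxx ?(negbTE necse).
  have eB : e \in B by move: ce; rewrite /separates (negbTE cB); case: (e \in B).
  exists e, c; split=> // j jk; have [t xt] := tP j; exists t; split.
    rewrite ffunE -[RHS](card_ord_lt jk); apply: eq_card => l.
    by rewrite !inE xt; case: ifP; rewrite ?eqxx // eq_sym (negbTE necse).
  by move=> a ae ac; exact: (other _ _ _ xt).
have grow m : (m.+1 <= #|A|)%N -> exists2 C : {set A}, #|C| = m.+1 &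
    exists ts : seq V, [/\ size ts = (m * k + 1)%N,
      uniq [seq parikh x k s t | t <- ts] &
      forall t a, t \in ts -> a \notin C -> parikh x k s t a = 0%N].
  elim: m => [_|m IH mA].
    have /card_gt0P[a0 _] : (0 < #|A|)%N by apply: leq_trans A2.
    have PB : proper_nonempty [set a0]%SET.
      rewrite /proper_nonempty -cards_eq0 cards1/= properEcard finset.subsetT.
      by rewrite cardsT cards1.
    (* Here [c] is [a0], and j = 0 gives the constant pattern. *)
    have [c [e [cB eB]]] := mix _ PB; move=> /(_ 0%N isT)[t [te ta]].
    exists [set a0]%SET; first by rewrite cards1.
    exists [:: t]; split=> // t' a; rewrite mem_seq1 => /eqP-> aC.
    have [->//|ae] := eqVneq a e; apply: ta => //.
    by apply: contraNneq aC => ->.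
  have [C cC [ts [szts uts tsC]]] := IH (ltnW mA).
  have PC : proper_nonempty C.
    by rewrite /proper_nonempty -cards_eq0 cC/= properEcard finset.subsetT cardsT cC.
  have [c [e [cB eB tP]]] := mix _ PC.
  have /choice[t0 t0P] j : exists t, (j <= k)%N -> parikh x k s t e = j /\
      forall a, a != c -> a != e -> parikh x k s t a = 0%N.
    by case: (leqP j k) => [/tP[t]|_]; [exists t|exists 0].
  exists (e |: C)%SET; first by rewrite cardsU1 eB cC.
  (* The value j = 0 is left out: a pattern without [e] may repeat an old vector. *)
  have new_range j : j \in iota 1 k -> (0 < j <= k)%N.
    by rewrite mem_iota add1n ltnS.
  exists ([seq t0 j | j <- iota 1 k] ++ ts); split.
  - by rewrite size_cat size_map size_iota szts mulSn addnA.
  - rewrite map_cat cat_uniq uts andbT; apply/andP; split.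
      rewrite -map_comp map_inj_in_uniq ?iota_uniq // => j j'.
      move=> /new_range/andP[_ jk] /new_range/andP[_ j'k] /=.
      move=> /(congr1 (fun P : {ffun A -> nat} => P e)).
      by have [-> _] := t0P _ jk; have [-> _] := t0P _ j'k.
    apply/hasPn => _ /mapP[t tts ->].
    apply/negP => /mapP[_ /mapP[j /new_range/andP[j0 jk] ->]].
    move=> /(congr1 (fun P : {ffun A -> nat} => P e)).
    have [-> _] := t0P _ jk; rewrite tsC // => E; by rewrite -E in j0.
  - move=> t a; rewrite mem_cat finset.in_setU1 negb_or => tt /andP[ae aC].
    move: tt => /orP[|tts].
      move=> /mapP[j /new_range/andP[_ jk] ->]; have [_ H] := t0P _ jk.
      by apply: H => //; apply: contraNneq aC => ->.
    exact: tsC.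
have [C _ [ts [szts uts _]]] := grow #|A|.-1 ltac:(by rewrite prednK // ltnW).
by exists ts; rewrite // subn1.
Qed.

(** Enumerating [S] by [s] turns the letter counts of an S-factor into a Parikh vector, so distinct
    vectors lie in distinct blocks of the partition. *)
Lemma abelian_complexity_ge (A : finType) (x : Z2 -> A) (k : nat)
    (s : nat -> Z2) (ts : seq Z2) :
  {in gtn k &, injective s} -> uniq [seq parikh x k s t | t <- ts] ->
  exists2 S : {fset Z2}, #|` S| = k & (size ts <= abelian_complexity x S)%N.
Proof.
move=> sinj uts.
pose S := [fset s (val l) | l in [set: 'I_k]%SET]%fset.
have sS (l : 'I_k) : s l \in S by apply/imfsetP; exists l; rewrite //= finset.in_setT.
pose g (l : 'I_k) : S := [` sS l]%fset.
have ginj : injective g.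
  move=> l l' /(congr1 val) /= ll'; apply: val_inj.
  by apply: sinj => //; exact: ltn_ord.
have gsurj (u : S) : exists l, u = g l.
  have /imfsetP[l _ ul] := valP u; exists l; exact: val_inj.
exists S.
  rewrite card_in_imfset /=; first by rewrite -cardE cardsT card_ord.
  by move=> l l' _ _ ll'; apply: val_inj; apply: sinj => //; exact: ltn_ord.
have parikhE t a : #|[pred u | S_factor x S t u == a]| = parikh x k s t a.
  rewrite ffunE -(fintype.card_image ginj); apply: eq_card => u; rewrite inE.
  have [l ->] := gsurj u; rewrite (fintype.mem_image ginj).
  by rewrite inE ffunE.
have facS t : S_factor x S t \in factors x S by rewrite inE; apply/asboolP; exists t.
pose blk t := [set y in factors x S | abelian_equiv (S_factor x S t) y]%SET.
have blkP t t' : blk t = blk t' -> parikh x k s t = parikh x k s t'.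
  move=> E; have : S_factor x S t' \in blk t.
    by rewrite E; apply/setIdP; split; [exact: facS|apply/forallP => a; exact: eqxx].
  move=> /setIdP[_ /forallP H]; apply/ffunP => a; rewrite -!parikhE.
  exact/eqP/H.
have ublk : uniq [seq blk t | t <- ts].
  elim: ts uts => //= t ts IH /andP[tts /IH->]; rewrite andbT.
  by apply: contra tts => /mapP[t' t'ts /blkP->]; exact: map_f.
rewrite -(size_map blk) /abelian_complexity cardE; apply: uniq_leq_size => // b.
move=> /mapP[t _ ->]; rewrite mem_enum; apply/imsetP.
by exists (S_factor x S t); first exact: facS.
Qed.

(** * Angles and the distance between lines *)

Lemma abs_sin_le (R : realType) (y : R) : `|sin y| <= `|y|.
Proof.
wlog y0 : y / 0 <= y => [H|].
  have [/H//|/ltW y0] := leP 0 y.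
  by rewrite -normrN -sinN -[leRHS]normrN; apply: H; rewrite oppr_ge0.
have [|c _] := @MVT_segment R sin cos 0 y y0.
  by apply/continuous_subspaceT/continuous_sin.
rewrite sin0 !subr0 => ->; rewrite normrM ler_piMl //; exact: cos_max.
Qed.

Lemma sin_intpi (R : realType) (m : int) : sin (m%:~R * pi : R) = 0.
Proof.
have nat n : sin (n%:R * pi : R) = 0.
  by elim: n => [|n IH]; rewrite ?mul0r ?sin0 // -natr1 mulrDl mul1r sinDpi IH oppr0.
by case: (intP m) => [|n|n]; rewrite ?mul0r ?sin0 // ?mulrNz ?mulNr ?sinN ?nat ?oppr0.
Qed.

Lemma abs_sinB_intpi (R : realType) (y : R) (m : int) :
  `|sin (y - m%:~R * pi)| = `|sin y|.
Proof. by rewrite sinB sin_intpi mulr0 subr0 normrM sin0cos1 ?sin_intpi // mulr1. Qed.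

Lemma line_through_eq (R : realType) (u v : R * R) : u != 0 -> v != 0 ->
  u.1 * v.2 = u.2 * v.1 -> line_through u = line_through v.
Proof.
have sub (a b : R * R) : b != 0 -> a.1 * b.2 = a.2 * b.1 ->
    line_through a `<=` line_through b.
  move=> b0 ab _ [c _ <-].
  have [b1|b1] := eqVneq b.1 0.
    have b2 : b.2 != 0.
      by apply: contraNneq b0 => b2; rewrite [b]surjective_pairing b1 b2.
    have a1 : a.1 = 0 by apply: (mulIf b2); rewrite ab b1 mulr0 mul0r.
    by exists (c * a.2 / b.2) => //; rewrite a1 b1 !mulr0 divfK.
  exists (c * a.1 / b.1) => //; congr pair; first by rewrite divfK.
  by rewrite mulrAC -[c * a.1 * _]mulrA ab mulrA mulfK.
by move=> u0 v0 uv; rewrite eqEsubset; split; apply: sub => //; rewrite mulrC -uv mulrC.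
Qed.

Lemma angle_exists (R : realType) (u : R * R) : u != 0 ->
  exists theta, has_angle (line_through u) theta.
Proof.
move=> u0; pose n := Num.sqrt (u.1 ^+ 2 + u.2 ^+ 2).
have s0 : 0 < u.1 ^+ 2 + u.2 ^+ 2.
  rewrite lt_def addr_ge0 ?sqr_ge0 // andbT paddr_eq0 ?sqr_ge0 // !sqrf_eq0.
  by apply: contra u0 => /andP[/eqP u1 /eqP u2]; rewrite [u]surjective_pairing u1 u2.
have n0 : 0 < n by rewrite sqrtr_gt0.
have nn : n ^+ 2 = u.1 ^+ 2 + u.2 ^+ 2 by rewrite sqr_sqrtr // ltW.
have c1 : -1 <= u.1 / n <= 1.
  rewrite -ler_norml normrM normfV (gtr0_norm n0) ler_pdivrMr // mul1r.
  by rewrite -sqrtr_sqr ler_wsqrtr // lerDl sqr_ge0.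
have cs : sin (acos (u.1 / n)) = `|u.2| / n.
  have -> : `|u.2| / n = Num.sqrt ((u.2 / n) ^+ 2).
    by rewrite sqrtr_sqr normrM normfV (gtr0_norm n0).
  rewrite sin_acos // !exprMn !exprVn nn; congr Num.sqrt.
  by field; rewrite gt_eqF.
have nz theta : (cos theta, sin theta) != 0 :> R * R.
  apply/eqP => -[c0 s00]; have := cos2Dsin2 theta.
  by rewrite c0 s00 expr0n addr0 => /eqP; rewrite eq_sym oner_eq0.
(* The arccosine covers the upper half plane; below it the angle changes sign. *)
have [u2|u2] := leP 0 u.2.
  exists (acos (u.1 / n)); apply: line_through_eq => //=.
  rewrite cs acosK ?in_itv //= ger0_norm //.
  by rewrite mulrA mulrC [RHS]mulrC !mulrA [u.2 * _]mulrC.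
exists (- acos (u.1 / n)); apply: line_through_eq => //=.
by rewrite cosN sinN cs acosK ?in_itv //= ltr0_norm // mulNr opprK mulrCA.
Qed.

Lemma angle_scale (R : realType) (u : R * R) (theta : R) :
  has_angle (line_through u) theta ->
  exists a, [/\ u.1 = a * cos theta, u.2 = a * sin theta &
                `|a| = Num.sqrt (u.1 ^+ 2 + u.2 ^+ 2)].
Proof.
rewrite /has_angle => L.
have : line_through u u by exists 1 => //; rewrite !mul1r -surjective_pairing.
rewrite L => -[a _ <-] /=; exists a; split=> //.
by rewrite !exprMn -mulrDr cos2Dsin2 mulr1 sqrtr_sqr.
Qed.

(** Up to sign, the determinant of [u] and [v] is the product of their lengths and the sine of the
    angle difference. Since the sine is at most the angle in absolute value, the determinant over
    the lengths bounds every candidate distance below. *)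
Lemma dist_pi_gt0 (R : realType) (u v : R * R) : u != 0 -> v != 0 ->
  u.1 * v.2 != u.2 * v.1 -> 0 < dist_pi (line_through u) (line_through v).
Proof.
move=> u0 v0 uv; rewrite /dist_pi.
pose r (w : R * R) := Num.sqrt (w.1 ^+ 2 + w.2 ^+ 2).
have [tu tuP] := angle_exists u0; have [tv tvP] := angle_exists v0.
have bound theta phi (m : int) : has_angle (line_through u) theta ->
    has_angle (line_through v) phi ->
    `|u.1 * v.2 - u.2 * v.1| <= r u * r v * `|theta - phi - m%:~R * pi|.
  move=> /angle_scale[a [u1 u2 ra]] /angle_scale[b [v1 v2 rb]].
  have -> : u.1 * v.2 - u.2 * v.1 = - (a * b) * sin (theta - phi).
    by rewrite u1 u2 v1 v2 sinB; ring.
  rewrite !normrM normrN normrM ra rb ler_wpM2l ?mulr_ge0 ?sqrtr_ge0 //.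
  by rewrite -(abs_sinB_intpi _ m); exact: abs_sin_le.
have c0 : 0 < `|u.1 * v.2 - u.2 * v.1| by rewrite normr_gt0 subr_eq0.
have r0 : 0 < r u * r v.
  rewrite lt_def mulr_ge0 ?sqrtr_ge0 // andbT; apply: contraTneq c0 => r0.
  by rewrite -leNgt; apply: le_trans (bound _ _ 0 tuP tvP) _; rewrite r0 mul0r.
apply: lt_le_trans (divr_gt0 c0 r0) _; apply: lb_le_inf.
  by exists `|tu - tv - 0%:~R * pi|, tu, tv, 0.
move=> _ [theta [phi [m [ut vp ->]]]].
by rewrite ler_pdivrMr // [leRHS]mulrC; exact: bound.
Qed.

Lemma dist_pi_refl_le0 (R : realType) (L : set (R * R)) : dist_pi L L <= 0.
Proof.
have [[theta Lt]|noangle] := pselect (exists theta, has_angle L theta).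
  apply: ge_inf; first by exists 0 => _ [? [? [? [_ _ ->]]]].
  by exists theta, theta, 0; split=> //; rewrite subrr mul0r subr0 normr0.
(* A set without angles gives an empty infimum, whose value is 0 by convention. *)
rewrite /dist_pi (_ : [set d | _] = set0) ?inf0 //.
by rewrite -subset0 => d [theta [_ [_ [Lt _ _]]]]; apply: noangle; exists theta.
Qed.

(** * From the recurrence hypotheses to good returns *)

Definition parallel (p q : Z2) : bool := p.1 * q.2 == p.2 * q.1.

Lemma int_pair_neq0 (R : realType) (z : Z2) :
  z != 0 -> (z.1%:~R, z.2%:~R) != 0 :> R * R.
Proof.
apply: contra => /eqP -[/eqP z1 /eqP z2].
by rewrite [z]surjective_pairing; move: z1 z2; rewrite !intr_eq0 => /eqP-> /eqP->.
Qed.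

Lemma dir_parallel (R : realType) (p q : Z2) : p != 0 -> q != 0 ->
  parallel p q -> dir p = dir q :> set (R * R).
Proof.
move=> /(int_pair_neq0 R) p0 /(int_pair_neq0 R) q0 /eqP pq.
apply: line_through_eq => //=.
by rewrite -!intrM pq.
Qed.

(** By Cramer's rule, periods with nonzero determinant are independent. *)
Lemma Per_parallel (T : Type) (y : Z2 -> T) (p q : Z2) :
  ~ doubly_periodic y -> Per y p -> Per y q -> parallel p q.
Proof.
move=> ndp yp yq; apply/negPn/negP => npq; apply: ndp; exists p, q; split=> //.
move=> a b ab.
have D0 : p.1 * q.2 - p.2 * q.1 != 0 by rewrite subr_eq0.
have e1 : p.1 * a + q.1 * b = 0.
  by move: (congr1 fst ab) => /=; rewrite !raddfMz /= -!mulrzz.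
have e2 : p.2 * a + q.2 * b = 0.
  by move: (congr1 snd ab) => /=; rewrite !raddfMz /= -!mulrzz.
split; apply: (mulfI D0); rewrite mulr0.
  have -> : (p.1 * q.2 - p.2 * q.1) * a =
      q.2 * (p.1 * a + q.1 * b) - q.1 * (p.2 * a + q.2 * b) by ring.
  by rewrite e1 e2 !mulr0 subrr.
have -> : (p.1 * q.2 - p.2 * q.1) * b =
    p.1 * (p.2 * a + q.2 * b) - p.2 * (p.1 * a + q.1 * b) by ring.
by rewrite e1 e2 !mulr0 subrr.
Qed.

Lemma proper_nonempty1 (A : finType) (a : A) :
  (2 <= #|A|)%N -> proper_nonempty [set a]%SET.
Proof.
move=> A2; rewrite /proper_nonempty -cards_eq0 cards1/= properEcard finset.subsetT.
by rewrite cardsT cards1.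
Qed.

Lemma not_Per_separates (A : finType) (x : Z2 -> A) (B : {set A}) (q : Z2) :
  ~ Per (letter_proj B x) q -> exists z, separates B (x z) (x (z + q)).
Proof. by move=> /existsNP[z /eqP zq]; exists z; rewrite /separates eq_sym. Qed.

Lemma returns_le (A : finType) (x : Z2 -> A) (M N : nat) (q : Z2) :
  (M <= N)%N -> returns x N q -> returns x M q.
Proof. by move=> MN Nq [a b] [/= a_le b_le]; apply: Nq; split=> /=; lia. Qed.

Lemma Sigma_cover (F : seq Z2) :
  exists2 N : nat, (1 <= N)%N & forall z, z \in F -> Sigma N z.
Proof.
elim: F => [|[a b] F [N N1 NF]]; first by exists 1%N.
exists (N + `|a| + `|b|)%N; first by lia.
move=> [c d]; rewrite in_cons => /orP[/eqP[-> ->]|/NF[/= z1 z2]]; split=> /=; lia.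
Qed.

Lemma aperiodic_recurrentP (A : finType) (x : Z2 -> A) :
  (forall N : nat, (1 <= N)%N -> exists2 q, returns x N q &
    forall B : {set A}, proper_nonempty B -> ~ Per (letter_proj B x) q) ->
  aperiodic_recurrent x.
Proof.
move=> H F; have [N N1 NF] := Sigma_cover F; have [q qN qB] := H N N1.
exists q => [z /NF /qN//|B /qB]; exact: not_Per_separates.
Qed.

(** Each nonzero H_B lies on one line, at positive distance from the transverse direction. A return
    closer to that direction than the least of these finitely many distances lies in no H_B. *)
Lemma transverse_aperiodic_recurrent (R : realType) (A : finType) (x : Z2 -> A)
    (theta : set (R * R)) :
  ~ doubly_periodic_by_projection x -> transverse_directions x theta ->
  aperiodic_recurrent x.
Proof.
move=> ndp [[[v v0 ->] rec] nbad]; apply: aperiodic_recurrentP => N N1.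
have /choice[eps epsP] (B : {set A}) : exists e : R, 0 < e /\
    (proper_nonempty B -> forall q, q != 0 -> Per (letter_proj B x) q ->
      e <= dist_pi (dir q) (line_through v)).
  have [PB|nPB] := pselect (proper_nonempty B); last by exists 1; split.
  have [P0|nP0] := pselect (Per (letter_proj B x) = [set 0]).
    by exists 1; split=> // _ q q0; rewrite P0 => qq; rewrite qq eqxx in q0.
  (* If every nonzero period pointed along the line of [v], that line would be a bad direction. *)
  have [h [Ph h0 hv]] : exists h, [/\ Per (letter_proj B x) h, h != 0 &
      dir h <> line_through v].
    apply: contrapT => noh; apply: nbad; exists B; split=> // h Ph h0.
    by apply: contrapT => hv; apply: noh; exists h.
  exists (dist_pi (dir h) (line_through v)); split.
    have hR := int_pair_neq0 R h0.
    apply: dist_pi_gt0 => //; apply/eqP => E; apply: hv.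
    exact: line_through_eq.
  move=> _ q q0 Pq; rewrite (dir_parallel _ q0 h0) //.
  by apply: Per_parallel Pq Ph => dp; apply: ndp; exists B.
pose e := \big[Order.min/1]_B eps B.
have e0 : 0 < e by apply: lt_bigmin => // B _; have [] := epsP B.
have [q [q0 qN qe]] := rec e N e0 N1.
exists q => // B PB Pq; have [_ /(_ PB q q0 Pq)] := epsP B.
by rewrite leNgt (lt_le_trans qe) // /e bigmin_le.
Qed.

Lemma parallel_trans (w u v : Z2) : w != 0 -> parallel w u -> parallel w v ->
  parallel u v.
Proof.
move=> w0 /eqP wu /eqP wv; apply/eqP.
have [w1|w1] := eqVneq w.1 0.
  have w2 : w.2 != 0.
    by apply: contraNneq w0 => w2; rewrite [w]surjective_pairing w1 w2.
  apply: (mulfI w2).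
  have -> : w.2 * (u.1 * v.2) = v.2 * (w.2 * u.1) by ring.
  have -> : w.2 * (u.2 * v.1) = u.2 * (w.2 * v.1) by ring.
  by rewrite -wu -wv w1; ring.
apply: (mulfI w1).
have -> : w.1 * (u.1 * v.2) = u.1 * (w.1 * v.2) by ring.
have -> : w.1 * (u.2 * v.1) = v.1 * (w.1 * u.2) by ring.
by rewrite wu wv; ring.
Qed.

(** The point [w'] lies on the line through 0 and [w] and on the line through -u and [w]; these meet
    only at [w]. *)
Lemma parallel_shift_inj (u w w' : Z2) : ~~ parallel u w ->
  parallel w w' -> parallel (u + w) (u + w') -> w' = w.
Proof.
rewrite /parallel -subr_eq0 => D /eqP ww /eqP /= uw.
have e1 : (w.1 * w'.2 - w.2 * w'.1) = 0 by rewrite ww subrr.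
have e2 : ((u.1 + w.1) * (u.2 + w'.2) - (u.2 + w.2) * (u.1 + w'.1)) = 0.
  by rewrite uw subrr.
rewrite [w]surjective_pairing [w']surjective_pairing.
congr pair; apply/eqP; rewrite -subr_eq0; apply/eqP; apply: (mulfI D); rewrite mulr0.
  transitivity (w.1 * ((u.1 + w.1) * (u.2 + w'.2) - (u.2 + w.2) * (u.1 + w'.1))
    - (u.1 + w.1) * (w.1 * w'.2 - w.2 * w'.1)); first by ring.
  by rewrite e1 e2; ring.
transitivity (w.2 * ((u.1 + w.1) * (u.2 + w'.2) - (u.2 + w.2) * (u.1 + w'.1))
    - (u.2 + w.2) * (w.1 * w'.2 - w.2 * w'.1)); first by ring.
by rewrite e1 e2; ring.
Qed.

(** If no return were good, both a return [w] nonparallel to [u] and the sum u + w would be periods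
    of projections; a large enough window for [w] rules out every pair of projections. *)
Lemma nonparallel_aperiodic_recurrent (A : finType) (x : Z2 -> A) :
  ~ doubly_periodic_by_projection x ->
  (forall N : nat, (1 <= N)%N -> exists u v,
    [/\ u != 0, returns x N u, returns x N v & ~~ parallel u v]) ->
  aperiodic_recurrent x.
Proof.
move=> ndp rec; apply: aperiodic_recurrentP => N N1; apply: contrapT => noq.
have PerB q : returns x N q -> exists B : {set A},
    proper_nonempty B /\ Per (letter_proj B x) q.
  move=> qN; apply: contrapT => nB; apply: noq; exists q => // B PB Pq.
  by apply: nB; exists B.
have par (B : {set A}) p q : proper_nonempty B -> Per (letter_proj B x) p ->
    Per (letter_proj B x) q -> parallel p q.
  by move=> PB; apply: Per_parallel => dp; apply: ndp; exists B.
have escape w M : (1 <= M)%N -> w != 0 -> exists2 q, returns x M q & ~~ parallel w q.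
  move=> M1 w0; have [u [v [_ uM vM uv]]] := rec M M1.
  have [wu|wu] := boolP (parallel w u); last by exists u.
  by exists v => //; apply: contra uv; exact: parallel_trans.
(* If x has a period w, every nonzero H_B is parallel to w.  Otherwise each pair
   (B, B') excludes at most one w nonparallel to u with w in H_B and u + w in
   H_B', and that w stops being a return on large windows. *)
have [[w [w0 wP]]|noper] := pselect (exists w, w != 0 /\ Per x w).
  have [q qN wq] := escape w N N1 w0; have [B [PB Pq]] := PerB q qN.
  by move/negP: wq; apply; apply: par PB _ Pq => t; rewrite /letter_proj wP.
have [[u1 u2] [_ [u0 uN _ _]]] := rec N N1; set u := (u1, u2) in u0 uN.
have /choice[M MP] (BB : {set A} * {set A}) : exists M : nat, forall w,
    ~~ parallel u w -> returns x M w -> proper_nonempty BB.1 ->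
    proper_nonempty BB.2 -> Per (letter_proj BB.1 x) w ->
    Per (letter_proj BB.2 x) (u + w) -> False.
  apply: contrapT => /forallNP noM.
  have bad M : exists w, [/\ ~~ parallel u w, returns x M w, proper_nonempty BB.1,
      proper_nonempty BB.2 &
      Per (letter_proj BB.1 x) w /\ Per (letter_proj BB.2 x) (u + w)].
    apply: contrapT => nw; apply: (noM M) => w *.
    by apply: nw; exists w; split.
  have [w [uw _ P1 P2 [w1 w2]]] := bad 0%N.
  have w0 : w != 0 by apply: contraNneq uw => ->; rewrite /parallel !mulr0.
  have [t xt] : exists t, x (t + w) <> x t.
    by apply/existsNP => wP; apply: noper; exists w.
  (* On a window containing [t], uniqueness forces [w'] to be [w], which would then return at
     [t]. *)
  have [M _ Mt] := Sigma_cover [:: t].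
  have [w' [_ w'M _ _ [w'1 w'2]]] := bad M.
  apply: xt; rewrite -(@parallel_shift_inj u w w') //; first last.
  - exact: par P2 w2 w'2.
  - exact: par P1 w1 w'1.
  by apply: w'M; apply: Mt; rewrite mem_head.
(* The size of [u] is added so that u + w still returns on the window N; the maximum handles all
   pairs of sets. *)
pose K := (N + `|u1| + `|u2| + \max_BB M BB)%N.
have MK BB : (M BB <= K)%N by apply: leq_trans (leq_addl _ _); exact: leq_bigmax.
have uK : (N + `|u1| + `|u2| <= K)%N by exact: leq_addr.
have NK : (N <= K)%N by apply: leq_trans uK; rewrite -addnA leq_addr.
have [w wK uw] := escape u K (leq_trans N1 NK) u0.
have [B [PB Bw]] := PerB w (returns_le NK wK).
have uwN : returns x N (u + w).
  move=> [a b] ab; rewrite addrA wK; first exact: uN.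
  by move: ab => [/= a_le b_le]; split=> /=; lia.
have [B' [PB' B'w]] := PerB _ uwN.
exact: (MP (B, B') w uw (returns_le (MK _) wK)).
Qed.

Lemma strongly_recurrent_nonparallel (R : realType) (A : finType) (x : Z2 -> A) :
  strongly_recurrent R x -> forall N : nat, (1 <= N)%N -> exists u v,
    [/\ u != 0, returns x N u, returns x N v & ~~ parallel u v].
Proof.
move=> [delta delta0 rec] N N1; have [u [v [u0 v0 uN vN duv]]] := rec N N1.
exists u, v; split=> //; apply: contraL delta0 => /(dir_parallel R u0 v0) uv.
by rewrite -leNgt; apply: le_trans duv _; rewrite uv; exact: dist_pi_refl_le0.
Qed.

(** * The complexity bound *)

(** For l < l', the pattern with cut l' shows [c] at [s l] and [e] at [s l']. *)
Lemma patterns_inj (V : zmodType) (A : finType) (x : V -> A) (s : nat -> V)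
    (c e : A) :
  c != e ->
  (forall j, exists t, forall l, x (t + s l) = if (l < j)%N then c else e) ->
  injective s.
Proof.
move=> ce pat; have ne l l' : (l < l')%N -> s l <> s l'.
  move=> ll' sl; have [t xt] := pat l'; move/eqP: ce; apply.
  by have := xt l'; rewrite -sl xt ll' ltnn.
by move=> l l' sl; case: (ltngtP l l') => // /ne; rewrite sl.
Qed.

Theorem theorem1p5 (R : realType) (A : finType) (r : nat) (hA : #|A| = r)
    (hr : (2 <= r)%N) (x : Z2 -> A)
    (hx : ~ doubly_periodic_by_projection x)
    (hrec : (exists theta : set (R * R), transverse_directions x theta)
            \/ strongly_recurrent R x)
    (k : nat) (hk : (0 < k)%N) :
  ((((r - 1) * k + 1)%N%:R)%:E <= max_pattern_abelian_complexity x R k)%E.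
Proof.
have xrec : aperiodic_recurrent x.
  case: hrec => [[theta]|/strongly_recurrent_nonparallel].
    exact: transverse_aperiodic_recurrent.
  exact: nonparallel_aperiodic_recurrent.
rewrite -hA in hr *.
have [s pat] := two_letter_patterns xrec.
have /card_gt0P[a _] : (0 < #|A|)%N by apply: leq_trans hr.
(* A single proper set, here a singleton, already yields patterns that force [s] to be injective. *)
have [c [e [ce cepat]]] := pat _ (proper_nonempty1 a hr).
have sinj : injective s.
  by apply: patterns_inj cepat; apply: contraNneq ce => ->; rewrite /separates eqxx.
have [ts <- uts] := many_parikh_vectors k hr pat.
have [S cS tsS] := abelian_complexity_ge (in2W sinj) uts.
apply: ereal_sup_ge; exists (abelian_complexity x S)%:R%:E; first by exists S.
by rewrite lee_fin ler_nat.
Qed.
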